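(* Let $G$ be a countable, finitely generated amenable group and let $A$ be a finite set. Every non-trivial (i.e., of cardinality greater than one) strongly irreducible shift $X\subseteq A^G$ is a non-isolated point of the space $\mathfrak{S}$ of all shifts in $A^G$.
   Context: $A^G$ carries the product topology ($A$ discrete), and $G$ acts on it by $[gx](h)=x(g^{-1}h)$. A shift is a closed $G$-invariant subset $X\subseteq A^G$. For finite $K\subset G$, $x_K$ is the restriction of $x$ to $K$ and $X_K=\{x_K : x\in X\}$. The space $\mathfrak{S}$ of all shifts in $A^G$ has the Hausdorff topology, which is compact and Polish; $X^n\to X$ if and only if for every finite $K\subset G$ one has $X^n_K=X_K$ for all large enough $n$. Fix a left-invariant word metric $d$ on $G$. A shift $X$ is strongly irreducible if there is $r\in\mathbb{N}$ such that for all finite $K,H\subset G$ with $d(k,h)>r$ for all $k\in K$, $h\in H$, and all $x,y\in X$, there is $z\in X$ with $z_K=x_K$ and $z_H=y_H$.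
   Formalization: The group G is additionally assumed infinite (''countable'' is read as countably infinite); for finite G the space of shifts is finite and discrete, so every shift is isolated and the claim fails, e.g. for the full shift on {0,1}. *)

(* Defs.v *)
From HB Require Import structures.
From mathcomp Require Import all_boot all_order all_algebra finmap.
From mathcomp Require Import all_classical all_reals all_analysis.

Set Implicit Arguments.
Unset Strict Implicit.
Unset Printing Implicit Defensive.

Import Order.TTheory GRing.Theory Num.Theory.
Local Open Scope classical_set_scope.

Section Groups.
Context {G : groupType}.
Implicit Types (S w : seq G) (g h : G) (n : nat).

Local Open Scope group_scope.

Definition spells S w g :=
  all (fun x => (x \in S) || (x^-1 \in S)) w /\ \prod_(x <- w) x = g.

Definition spelled_in S n g := exists2 w, size w = n & spells S w g.

(* Stated with a length and a boolean predicate so that [ex_minn] applies. *)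
Definition generates S := forall g, exists n, `[< spelled_in S n g >].

Definition word_length S (genS : generates S) g : nat := ex_minn (genS g).

Definition word_dist S (genS : generates S) g h : nat :=
  word_length genS (g^-1 * h).

Definition ltranslate g (F : {fset G}) : {fset G} := [fset g * x | x in F]%fset.

Definition symdiff (E F : {fset G}) : {fset G} := ((E `\` F) `|` (F `\` E))%fset.

End Groups.

(* Folner condition, with left translates of F. *)
Definition amenable (G : groupType) : Prop :=
  forall (K : {fset G}) (e : rat), (0 < e)%R ->
  exists2 F : {fset G}, F != fset0 &
    forall g, g \in K ->
      (#|` symdiff (ltranslate g F) F|%:R <= e * #|` F|%:R)%R.

Definition config (G : groupType) (A : finType) : Type :=
  {ptws G -> discrete_topology A}.

HB.instance Definition _ (G : groupType) (A : finType) :=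
  Uniform.copy (config G A) {ptws G -> discrete_topology A}.

Definition translate (G : groupType) (A : finType) (g : G) (x : config G A) :
  config G A := fun h => x (g^-1 * h)%g.

Record subshift (G : groupType) (A : finType) := Subshift {
  shift_set :> set (config G A);
  shift_closed : closed shift_set;
  shift_invariant : forall g x, shift_set x -> shift_set (translate g x) }.

Definition patterns (G : groupType) (A : finType) (K : set G)
  (X : set (config G A)) : set (K -> A) := sigL K @` X.
Arguments patterns {G A} K X.

Definition strongly_irreducible (G : groupType) (A : finType) (S : seq G)
    (genS : generates S) (X : subshift G A) : Prop :=
  exists r : nat, forall K H : set G, finite_set K -> finite_set H ->
    (forall k h, K k -> H h -> (r < word_dist genS k h)%N) ->
    forall x y, shift_set X x -> shift_set X y ->
    exists z, [/\ shift_set X z, sigL K z = sigL K x & sigL H z = sigL H y].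

HB.instance Definition _ (G : groupType) (A : finType) :=
  gen_eqMixin (subshift G A).
HB.instance Definition _ (G : groupType) (A : finType) :=
  gen_choiceMixin (subshift G A).

Section Hausdorff.
Local Open Scope relation_scope.
Context {G : groupType} {A : finType}.
Implicit Types (X Y : subshift G A) (E : set (config G A * config G A)).

(* X and Y are E-close when each lies in the E-neighbourhood of the other;
   for the entourage E = { d < eps } of a metric d compatible with the
   topology of A^G, this says that the Hausdorff distance is small. *)
Definition hausdorff_close E : set (subshift G A * subshift G A) :=
  [set XY | (forall x, shift_set XY.1 x -> exists2 y, shift_set XY.2 y & E (x, y)) /\
            (forall y, shift_set XY.2 y -> exists2 x, shift_set XY.1 x & E (x, y))].

Definition hausdorff_ent : set_system (subshift G A * subshift G A) :=
  filter_from entourage hausdorff_close.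

Let hausdorff_ent_filter : Filter hausdorff_ent.
Proof.
apply: filter_from_filter; first by exists setT; exact: entourageT.
move=> E F eE eF; exists (E `&` F); first exact: filterI.
move=> [X Y] [/= XY YX]; split; split=> /= x.
- by move=> /XY[y Yy []]; exists y.
- by move=> /YX[y Yy []]; exists y.
- by move=> /XY[y Yy []]; exists y.
- by move=> /YX[y Yy []]; exists y.
Qed.

Let hausdorff_ent_diagonal B : hausdorff_ent B -> diagonal `<=` B.
Proof.
move=> [E eE EB] [X Y] /diagonalP <-; apply: EB.
by split=> x Xx; exists x => //; exact: entourage_refl.
Qed.

Let hausdorff_ent_inv B : hausdorff_ent B -> hausdorff_ent B^-1.
Proof.
move=> [E eE EB]; exists E^-1; first exact: entourage_inv.
by move=> [X Y] [/= XY YX]; apply: EB; split.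
Qed.

Let hausdorff_ent_split B :
  hausdorff_ent B -> exists2 C, hausdorff_ent C & C \; C `<=` B.
Proof.
move=> [E eE EB]; have [F eF FE] := entourage_split_ex eE.
exists (hausdorff_close F); first by exists F.
move=> [X Z] [Y /= [/= XY YX] [/= YZ ZY]]; apply: EB; split=> /=.
- move=> x /XY[y /YZ[z Zz yz] xy]; exists z => //.
  by apply: FE; exists y.
- move=> z /ZY[y /YX[x Xx xy] yz]; exists x => //.
  by apply: FE; exists y.
Qed.

HB.instance Definition _ := isUniform.Build (subshift G A)
  hausdorff_ent_filter hausdorff_ent_diagonal hausdorff_ent_inv
  hausdorff_ent_split.

End Hausdorff.

Section ShiftSpace.
Context {G : groupType} {A : finType}.
Implicit Types (X Y : subshift G A) (K : set G).

Lemma shift_eq X Y : X = Y :> set (config G A) -> X = Y.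
Proof.
case: X Y => [X cX iX] [Y cY iY] /= XY; move: cX iX cY iY; rewrite XY => *.
by congr Subshift; exact: Prop_irrelevance.
Qed.

Lemma eq_patternP K (x y : config G A) :
  sigL K x = sigL K y <-> (forall k, K k -> x k = y k).
Proof.
by rewrite -eq_sigLP; split=> h k => [/mem_set|/set_mem]; exact: h.
Qed.

Lemma entourage_configP (E : set (config G A * config G A)) :
  entourage E <->
  exists2 K : set G, finite_set K &
    forall x y, sigL K x = sigL K y -> E (x, y).
Proof.
split.
- move=> [_ [F _ <-] FE].
  exists [set (projT1 p).1 | p in [set` F]].
    exact/finite_image/finite_fset.
  move=> x y /eq_patternP xyK; apply: FE => p Fp.
  have := xyK _ (ex_intro2 _ _ p Fp erefl).
  case: p Fp => -[/= k V] /asboolP [W eW WV] _ xyk; apply: WV => /=.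
  have : W (x k, y k) by rewrite xyk; exact: entourage_refl.
  by [].
- move=> [K /finite_fsetP[K' ->] KE].
  suff : entourage (\bigcap_(k in [set` K'])
      [set xy : config G A * config G A | xy.1 k = xy.2 k]).
    apply: filterS => -[x y] /= xyK; apply: KE.
    exact/eq_patternP.
  apply: filter_bigI => k _.
  pose D := [set ab : discrete_topology A * discrete_topology A | ab.1 = ab.2].
  have eD : entourage D by rewrite uniform_discrete => _ [a _ <-].
  have ek : @entourage (initial_topology (@proj G (fun=> discrete_topology A) k))
      [set xy | xy.1 k = xy.2 k] by exists D.
  set e : set _ := [set xy | _] in ek *.
  eexists; last exact: subset_refl.
  exists [fset exist _ (k : {classic G}, e) (asboolT ek)]%fset => //=.
    by move=> p _; rewrite in_setT.
  apply/seteqP; split=> xy /=.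
    by move=> /(_ (exist _ (k : {classic G}, e) (asboolT ek))); apply; exact: fset11.
  by move=> xyk p /fset1P ->.
Qed.

Lemma nbhs_shiftP X (U : set (subshift G A)) :
  nbhs X U <->
  exists2 K : set G, finite_set K &
    forall Y, patterns K Y = patterns K X -> U Y.
Proof.
rewrite -nbhs_entourageE; split.
- move=> [B [E /entourage_configP[K fK KE] EB] BU]; exists K => // Y YX.
  apply/BU/mem_set/EB; split=> /= x.
  + move=> Xx; have : patterns K Y (sigL K x) by rewrite YX; exists x.
    by move=> [y Yy yx]; exists y => //; apply: KE.
  + move=> Yx; have : patterns K X (sigL K x) by rewrite -YX; exists x.
    by move=> [y Xy yx]; exists y => //; apply: KE.
- move=> [K fK KU].
  exists (hausdorff_close [set xy | sigL K xy.1 = sigL K xy.2]).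
    by eexists; last exact: subset_refl; apply/entourage_configP; exists K.
  move=> Y /set_mem[/= XY YX]; apply: KU; apply/seteqP; split=> _ [x Zx <-].
  + by have [y Xy yx] := YX _ Zx; exists y.
  + by have [y Yy yx] := XY _ Zx; exists y.
Qed.

Lemma cvg_shiftP (X_ : nat -> subshift G A) X :
  X_ n @[n --> \oo] --> X <->
  forall K, finite_set K ->
    \forall n \near \oo, patterns K (X_ n) = patterns K X.
Proof.
split=> [XX K fK | XX U /nbhs_shiftP[K fK KU]].
- by apply: (XX [set Y | patterns K Y = patterns K X]); apply/nbhs_shiftP; exists K.
- by near do apply: KU; exact: XX.
Unshelve. all: by end_near. Qed.

End ShiftSpace.

(* Main.v *)
(* Suppose every shift with the same K-patterns as X equals X.  Let B be a
   finite window outside which X glues freely, T a large right-Folner set and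
   W = T B T^-1.  Since X has at least 2^(|T|/|B|) patterns on T, prescribing
   one pattern w on a translate of T divides the number of patterns by far more
   than any power of |W|, even after paying for the boundary of T.  Take
   D maximal among sets whose translates of T are pairwise B-separated and
   B-far from K: D has density about 1/|W|, and each K-pattern of X extends to
   a point of X carrying w on all of D T.  A union bound over the position of D
   in a large Folner window L shows that these points, together, do not see all
   the L-patterns of X.  The points of X avoiding a missed pattern q form a
   proper subshift with the same K-patterns. *)
Require Import Defs.
From mathcomp Require Import all_boot all_order all_algebra finmap.
From mathcomp Require Import all_classical all_reals all_analysis.
From mathcomp Require Import zify.

Set Implicit Arguments.
Unset Strict Implicit.
Unset Printing Implicit Defensive.

Import Order.TTheory GRing.Theory Num.Theory.
Local Open Scope classical_set_scope.

(** * Arithmetic of the union bound *)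

(** Bernoulli: [(1 - 1/(s+1))^k >= 1 - k/(s+1) >= 1/2]; [aux] is its first half cleared of
    denominators. *)
Lemma leq_expS_double (s k : nat) : (k.*2 <= s.+1 -> s.+1 ^ k <= 2 * s ^ k)%N.
Proof.
have aux j : (j <= s.+1 -> s.+1 ^ j * (s.+1 - j) <= s.+1 * s ^ j)%N.
  elim: j => [|j IH] js; first by rewrite !expn0 subn0 mul1n muln1.
  have {}IH := IH (ltnW js).
  rewrite !expnS mulnCA -mulnA.
  have : (s.+1 * (s.+1 - j.+1) <= s * (s.+1 - j))%N by nia.
  move=> /(leq_mul (leqnn (s.+1 ^ j))); nia.
move=> ks; have {}aux := aux k ltac:(lia).
have h : (s.+1 <= (s.+1 - k).*2)%N by lia.
rewrite -(leq_pmul2l (ltn0Sn s)) mulnCA.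
apply: leq_trans (leq_mul (leqnn 2) aux).
have := leq_mul (leqnn (s.+1 ^ k)) h; nia.
Qed.

(** The inequality that contradicts the union bound. Pad [n] to [k * m]: replacing [s.+1] by [s]
    costs a factor 2 in each of [m] blocks of length [k], and [2 < s]. *)
Lemma leq_expSD (s k n m : nat) : (2 < s -> k.*2 <= s.+1 -> 0 < m ->
  n <= k * m -> s.+1 ^ n < s ^ (n + m))%N.
Proof.
move=> s2 ks m0 nkm.
have s0 : (0 < s)%N by lia.
have e1 : (s.+1 ^ (k * m) <= 2 ^ m * s ^ (k * m))%N.
  rewrite !expnM -expnMn; case: m m0 nkm => // m _ _.
  by rewrite leq_exp2r // leq_expS_double.
have e2 : (2 ^ m < s ^ m)%N by rewrite ltn_exp2r.
have e3 : (s.+1 ^ n * s ^ (k * m - n) <= s.+1 ^ (k * m))%N.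
  rewrite -{2}(subnKC nkm) expnD leq_mul2l; apply/orP; right.
  by case: (k * m - n)%N => // j; rewrite leq_exp2r.
have q0 : (0 < s ^ (k * m - n))%N by rewrite expn_gt0 s0.
rewrite -(ltn_pmul2r q0); apply: leq_ltn_trans e3 _.
apply: leq_ltn_trans e1 _.
rewrite -expnD addnAC subnKC // expnD mulnC ltn_pmul2l // expn_gt0 s0 //.
Qed.

(** Binomial expansion of [(1 + s)^#|T|], with [E] the set of factors that contribute 1. *)
Lemma sum_expn_subset (T : finType) (s : nat) :
  (\sum_(E : {set T}) s ^ (#|T| - #|E|) = s.+1 ^ #|T|)%N.
Proof.
have := @bigA_distr nat 0%N 1%N muln addn T (fun=> 1%N) (fun=> s).
rewrite prod_nat_const => ->.
apply: eq_bigr => E _.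
rewrite (bigID (mem E)) /= [X in (_ = X * _)%N]big1 => [|i ->//].
rewrite mul1n (eq_bigr (fun=> s)) => [|i /negbTE->//].
rewrite prod_nat_const; congr (s ^ _)%N.
rewrite -(cardsC E) addKn; apply: eq_card => i; by rewrite inE.
Qed.

(* [be] is the size of a gluing window, [t] that of a Folner tile, and [j]
   bounds the bits lost at its boundary. *)
Lemma tile_count_beats (be t j : nat) : (0 < be)%N ->
  (be * (8 * (6 + 2 * be)) <= t -> 8 * be * j <= t ->
  (4 * (t * t * be)) ^ 2 * 2 ^ j <= 2 ^ (t %/ be))%N.
Proof.
move=> b0 tb jt.
set k := (t %/ be)%N.
have k1 : (8 * (6 + 2 * be) <= k)%N by rewrite leq_divRL // mulnC.
have tk : (t < k.+1 * be)%N by rewrite ltn_ceil.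
have jk : (8 * j <= k)%N by rewrite leq_divRL //; nia.
(* An eighth of the available exponent. As [t <= 2^(3 + u + be)], the square has exponent at most
   [16 + 4u + 6be <= 7u], and [j <= u] fits into the rest. *)
pose u := (k %/ 8)%N.
have uk : (8 * u <= k < 8 * u.+1)%N.
  by rewrite mulnC leq_divM /= mulnC ltn_ceil.
have u1 : (6 + 2 * be <= u)%N by rewrite leq_divRL // mulnC.
have be2 : (be <= 2 ^ be)%N by apply: ltnW; apply: ltn_expl.
have u2 : (u.+1 <= 2 ^ u)%N by apply: ltn_expl.
have t2 : (t <= 2 ^ 3 * 2 ^ u * 2 ^ be)%N.
  apply: (@leq_trans (8 * u.+1 * be)); first nia.
  by apply: leq_mul be2; apply: leq_mul.
have : (4 * (t * t * be) <= 2 ^ (8 + 2 * u + 3 * be))%N.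
  apply: (@leq_trans (4 * ((2 ^ 3 * 2 ^ u * 2 ^ be) * (2 ^ 3 * 2 ^ u * 2 ^ be)
     * 2 ^ be))).
    by rewrite leq_mul2l /= leq_mul // leq_mul.
  rewrite -[4%N]/(2 ^ 2)%N -!expnD leq_exp2l //; lia.
move=> h; apply: (@leq_trans ((2 ^ (8 + 2 * u + 3 * be)) ^ 2 * 2 ^ j)).
  by rewrite leq_mul2r leq_exp2r // h orbT.
rewrite -expnM -expnD leq_exp2l //; lia.
Qed.

(** * Products of finite sets and right Folner sets *)

Section FsetProduct.
Context {G : groupType}.
Implicit Types (A B T : {fset G}) (g h : G).
Local Open Scope group_scope.

Definition fset_mul A B : {fset G} := [fset x in [seq a * b | a <- A, b <- B]]%fset.
Definition fset_inv A : {fset G} := [fset x^-1 | x in A]%fset.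

Lemma fset_mulP A B x :
  reflect (exists a b, [/\ a \in A, b \in B & x = a * b]) (x \in fset_mul A B).
Proof.
rewrite in_fset; apply: (iffP allpairsP) => [[[a b] /= [aA bB ->]]|[a [b [aA bB ->]]]].
  by exists a, b.
by exists (a, b).
Qed.

Lemma mem_fset_mul A B a b : a \in A -> b \in B -> a * b \in fset_mul A B.
Proof. by move=> aA bB; apply/fset_mulP; exists a, b. Qed.

Lemma card_fset_mul A B : (#|` fset_mul A B| <= #|` A| * #|` B|)%N.
Proof. by rewrite card_fseq (leq_trans (size_undup _)) // size_allpairs. Qed.

Lemma mem_fset_inv A x : (x \in fset_inv A) = (x^-1 \in A).
Proof.
apply/imfsetP/idP => [[a /= aA ->]|xA]; first by rewrite invgK.
by exists x^-1; rewrite ?invgK.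
Qed.

Lemma card_fset_inv A : #|` fset_inv A| = #|` A|.
Proof. by rewrite card_imfset //; exact: invg_inj. Qed.

Lemma mem_ltranslate g A x : (x \in ltranslate g A) = (g^-1 * x \in A).
Proof.
apply/imfsetP/idP => [[a /= aA ->]|xA]; first by rewrite mulKg.
by exists (g^-1 * x); rewrite ?mulVKg.
Qed.

Lemma card_ltranslate g A : #|` ltranslate g A| = #|` A|.
Proof. by rewrite card_imfset //; exact: mulgI. Qed.

Lemma fset_mul_ltranslate g A B :
  fset_mul (ltranslate g A) B = ltranslate g (fset_mul A B).
Proof.
apply/fsetP => x; rewrite mem_ltranslate.
apply/fset_mulP/fset_mulP => -[a [b [aA bB e]]].
  by exists (g^-1 * a), b; rewrite -mem_ltranslate -mulgA -e.
by exists (g * a), b; rewrite mem_ltranslate mulKg -mulgA -e mulVKg.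
Qed.

Lemma ltranslateD g A B :
  ltranslate g (A `\` B)%fset = (ltranslate g A `\` ltranslate g B)%fset.
Proof. by apply/fsetP => x; rewrite !(mem_ltranslate, in_fsetD). Qed.

Lemma infinite_fset_card : infinite_set [set: G] ->
  forall A (n : nat), exists B, (A `<=` B)%fset /\ (n <= #|` B|)%N.
Proof.
move=> infG A; elim=> [|n [B [AB nB]]]; first by exists A.
have [x xB] : exists x, x \notin B.
  apply: contra_notP infG => /forallNP allB; apply/finite_fsetP; exists B.
  by apply/seteqP; split => // x _ /=; have /negP/negPn := allB x.
exists (x |` B)%fset; split; first by apply: fsubset_trans AB (fsubsetU1 _ _).
by rewrite cardfsU1 xB add1n ltnS.
Qed.

(* [amenable] speaks of left translates, so [T] is a translate of the inverse
   of a Folner set. *)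
Lemma amenable_right : infinite_set [set: G] -> amenable G ->
  forall B (N M : nat), exists T, [/\ 1 \in T, (N <= #|` T|)%N &
    (M * #|` (fset_mul T B `\` T)%fset| <= #|` T|)%N].
Proof.
move=> infG amG B N M.
have [K [BK NK]] := infinite_fset_card infG (fset_inv B) N.
(* The term [M * #|B|] pays for summing the boundary over [B]; the term [N] forces [F] to be
   large. *)
pose c := (M * #|` B| + N).+1.
have c0 : (0 < (c%:R : rat))%R by rewrite ltr0n.
have [F F0 KF] := amG K (c%:R^-1)%R ltac:(by rewrite invr_gt0).
have {}KF g : g \in K -> (c * #|` (ltranslate g F `\` F)%fset| <= #|` F|)%N.
  move=> /KF; rewrite -(ler_pM2l c0) mulrA divff ?gt_eqF // mul1r -natrM ler_nat.
  by apply: leq_trans; rewrite leq_mul2l fsubset_leq_card ?orbT // fsubsetUl.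
(* If [#|F| < N < c], every [g F] with [g] in [K] lies in [F], so [F] contains a translate [K f],
   which has at least [N] points. *)
have NF : (N <= #|` F|)%N.
  rewrite leqNgt; apply/negP => FN.
  have sub g : g \in K -> (ltranslate g F `<=` F)%fset.
    move=> /KF; rewrite -fsetD_eq0 -cardfs_eq0 /c; nia.
  have [f fF] := fset0Pn _ F0.
  have : (fset_mul K [fset f] `<=` F)%fset.
    apply/fsubsetP => _ /fset_mulP[g [_ [gK /fset1P-> ->]]].
    by apply: (fsubsetP (sub _ gK)); rewrite mem_ltranslate mulKg.
  move=> /fsubset_leq_card; rewrite leqNgt => /negP; apply.
  apply: (leq_trans FN); apply: (leq_trans NK).
  have <- : #|` [fset g * f | g in K]%fset| = #|` K|.
    by rewrite card_imfset //; exact: mulIg.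
  apply/fsubset_leq_card/fsubsetP => _ /imfsetP[g /= gK ->].
  by rewrite mem_fset_mul // fset11.
have [f fF] := fset0Pn _ F0.
exists (ltranslate f (fset_inv F)); split.
- by rewrite mem_ltranslate mulg1 mem_fset_inv invgK.
- by rewrite card_ltranslate card_fset_inv.
rewrite fset_mul_ltranslate -ltranslateD !card_ltranslate card_fset_inv.
suff : (c * #|` (fset_mul (fset_inv F) B `\` fset_inv F)%fset| <= #|` B| * #|` F|)%N.
  rewrite /c; nia.
(* Inversion turns the right boundary of [F^-1] into a union of left boundaries of [F]. *)
have -> : (fset_mul (fset_inv F) B `\` fset_inv F)%fset =
    (\bigcup_(b <- B) fset_inv (ltranslate b^-1 F `\` F))%fset.
  apply/fsetP => x; rewrite in_fsetD mem_fset_inv.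
  apply/andP/bigfcupP.
    move=> [xF /fset_mulP[a [b [aF bB xab]]]]; exists b; first by rewrite bB.
    rewrite mem_fset_inv in_fsetD xF mem_ltranslate invgK xab invgM mulVKg.
    by rewrite -mem_fset_inv.
  move=> [b /andP[bB _]]; rewrite mem_fset_inv in_fsetD mem_ltranslate invgK.
  move=> /andP[xF bxF]; split=> //; apply/fset_mulP; exists (x * b^-1), b.
  by rewrite mem_fset_inv invgM invgK mulgVK.
have leU (s : seq G) (H : G -> {fset G}) :
    (#|` \bigcup_(b <- s) H b|%fset <= \sum_(b <- s) #|` H b|)%N.
  elim/big_rec2 : _ => [|b n U _ h]; first by rewrite cardfs0.
  by rewrite (leq_trans (leq_card_fsetU _ _).1) // leq_add2l.
apply: leq_trans (leq_mul (leqnn c) (leU _ _)) _.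
rewrite big_distrr /= card_fset_sum1 big_distrl /= big_seq [leqRHS]big_seq.
apply: leq_sum => b bB; rewrite mul1n card_fset_inv KF //.
by apply: (fsubsetP BK); rewrite mem_fset_inv invgK.
Qed.

End FsetProduct.

(** A choice of related elements is injective because [q] determines [p]. Below, [R] mostly says
    that one configuration induces both patterns, which avoids naming a map between patterns. *)
Lemma leq_card_rel (T U : finType) (P : {set T}) (Q : {set U})
    (R : T -> U -> Prop) :
  (forall p, p \in P -> exists2 q, q \in Q & R p q) ->
  (forall p p' q, R p q -> R p' q -> p = p') -> (#|P| <= #|Q|)%N.
Proof.
move=> PQ Rinj; have [->|/finset.set0Pn[p0 p0P]] := eqVneq P finset.set0.
  by rewrite cards0.
have [q0 _ _] := PQ _ p0P.
have /choice[f fP] p : exists q, p \in P -> q \in Q /\ R p q.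
  have [/PQ[q qQ Rpq]|_] := boolP (p \in P); last by exists q0.
  by exists q.
rewrite -(card_in_imset (f := f)) => [|p p' /fP[_ Rp] /fP[_ Rp'] fpp'].
  by apply/subset_leq_card/fintype.subsetP => _ /imsetP[p /fP[qQ _] ->].
by apply: Rinj Rp _; rewrite fpp'.
Qed.

(** * Closed sets and compactness in the configuration space *)

Section Configurations.
Context {G : groupType} {A : finType}.
Implicit Types (x y z : config G A) (Z : set (config G A)).
Local Open Scope group_scope.

Lemma nbhs_agree x (M : {fset G}) :
  nbhs x [set z : config G A | forall g, g \in M -> z g = x g].
Proof.
rewrite -nbhs_entourageE.
exists [set xy : config G A * config G A | forall g, g \in M -> xy.2 g = xy.1 g].
  apply/entourage_configP; exists [set` M]; first exact: finite_fset.
  by move=> u v /eq_patternP uv g gM /=; rewrite uv.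
by move=> z /set_mem.
Qed.

Lemma closed_configP Z : closed Z <->
  forall x, (forall M : {fset G}, exists2 z, Z z & forall g, g \in M -> z g = x g) ->
    Z x.
Proof.
split=> [clZ x xZ|ZP x clx].
  apply: clZ => U; rewrite -nbhs_entourageE.
  move=> [E /entourage_configP[K /finite_fsetP[M ->] ME] EU].
  have [z Zz zM] := xZ M; exists z; split=> //; apply/EU/mem_set/ME/eq_patternP.
  by move=> g /zM.
by apply: ZP => M; have [z [Zz zM]] := clx _ (nbhs_agree x M); exists z.
Qed.

Lemma compact_config : compact [set: config G A].
Proof.
have cA : compact [set: discrete_topology A].
  by apply: finite_compact; exact: (@finite_finset A).
have := @tychonoff G (fun=> discrete_topology A) (fun=> setT) (fun=> cA).
by congr compact; apply/seteqP; split.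
Qed.

(** Compactness: the sets [S M] form a filter base, and a cluster point satisfies every constraint
    since each involves a single coordinate. *)
Lemma exists_config Z (Q : G -> A -> Prop) : closed Z ->
  (forall M : {fset G}, exists2 z, Z z & forall g, g \in M -> Q g (z g)) ->
  exists2 z, Z z & forall g, Q g (z g).
Proof.
move=> clZ ZQ.
pose S (M : {fset G}) := [set z | Z z /\ forall g, g \in M -> Q g (z g)].
have FF : ProperFilter (filter_from [set: {fset G}] S).
  apply: filter_from_proper => [|M _]; last by have [z Zz Qz] := ZQ M; exists z.
  apply: filter_from_filter; first by exists fset0.
  move=> M N _ _; exists (M `|` N)%fset => // z [Zz Qz].
  by split; split=> // g gM; apply: Qz; rewrite in_fsetU gM ?orbT.
have [x [_ clx]] := compact_config FF filterT.
exists x.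
  apply: clZ => U nU.
  have [|z [[Zz _] Uz]] := clx (S fset0) U _ nU; first by exists fset0.
  by exists z.
move=> g.
have [|z [[_ Qz] zx]] := clx (S [fset g]%fset) _ _ (nbhs_agree x [fset g]%fset).
  by exists [fset g]%fset.
by rewrite -zx ?fset11 //; apply: Qz; rewrite fset11.
Qed.

End Configurations.

(** * From the word metric to a finite gluing window *)

Section Gluing.
Context {G : groupType} {A : finType}.
Implicit Types (B K H : {fset G}).
Local Open Scope group_scope.

(** Strong irreducibility with the word ball replaced by any finite [B], so that separation becomes
    a condition on set products. *)
Definition gluing (X : set (config G A)) B :=
  forall K H, (forall k h, k \in K -> h \in H -> k^-1 * h \notin B) ->
  forall x y, X x -> X y ->
  exists z, [/\ X z, forall k, k \in K -> z k = x k & forall h, h \in H -> z h = y h].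

Lemma word_ball_finite (S : seq G) (genS : generates S) (r : nat) :
  exists B, forall g, (word_length genS g <= r)%N -> g \in B.
Proof.
(* Having 1 in [U] makes the powers [b n] increasing, so shorter words are covered too. *)
pose U := (1 |` [fset x in S] `|` fset_inv [fset x in S])%fset.
pose b n := iter n (fset_mul U) [fset 1]%fset.
have bS n g : g \in b n -> g \in b n.+1.
  by move=> gb; rewrite -[g]mul1g mem_fset_mul // !inE eqxx.
have spb w : all (fun x => (x \in S) || (x^-1 \in S)) w ->
    \prod_(x <- w) x \in b (size w).
  elim: w => [|u w IH] /= => [_|/andP[uS /IH wb]]; first by rewrite big_nil fset11.
  rewrite big_cons mem_fset_mul // !(in_fsetU, mem_fset_inv, in_fset).
  by move: uS => /orP[] ->; rewrite ?orbT.
exists (b r) => g; rewrite /word_length; case: ex_minnP => n /asboolP[w <- [wS <-]] _.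
move=> /subnKC <-; elim: (r - _)%N => [|k IH]; first by rewrite addn0; exact: spb.
by rewrite addnS; exact: bS.
Qed.

Lemma irreducible_gluing (S : seq G) (genS : generates S) (X : subshift G A) :
  strongly_irreducible genS X ->
  exists B, [/\ 1 \in B, forall b, b \in B -> b^-1 \in B & gluing X B].
Proof.
move=> [r irrX]; have [B0 B0P] := word_ball_finite genS r.
(* A larger window only strengthens the separation hypothesis, so it may be made symmetric and
   contain 1. *)
exists (1 |` (B0 `|` fset_inv B0))%fset; split.
- exact: fset1U1.
- move=> b; rewrite !inE !mem_fset_inv invgK.
  by case/or3P => [/eqP->|->|->]; rewrite ?invg1 ?eqxx ?orbT.
move=> K H KH x y Xx Xy.
have [|z [Xz /eq_patternP zK /eq_patternP zH]] :=
    irrX [set` K] [set` H] (finite_fset K) (finite_fset H) _ x y Xx Xy.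
  move=> k h kK hH; rewrite ltnNge; apply/negP => /B0P.
  by move=> kh; have := KH _ _ kK hH; rewrite !inE kh orbT.
by exists z; split.
Qed.

End Gluing.

(** * Counting patterns *)

Section PatternCount.
Context {G : groupType} {A : finType} (X : subshift G A).
Implicit Types (x y z : config G A) (L H K T : {fset G}).
Local Open Scope group_scope.

Definition restr L x : {ffun L -> A} := [ffun l => x (val l)].

Definition pats L : {set {ffun L -> A}} :=
  finset (fun f => `[< exists2 x, shift_set X x & f = restr L x >]).

Definition npat L : nat := #|pats L|.

Lemma restrP L x y : restr L x = restr L y <-> (forall l, l \in L -> x l = y l).
Proof.
split=> [/ffunP xy l lL|xy]; first by have := xy [` lL]%fset; rewrite !ffunE.
by apply/ffunP => l; rewrite !ffunE xy //; exact: fsvalP.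
Qed.

Lemma patsP L f :
  reflect (exists2 x, shift_set X x & f = restr L x) (f \in pats L).
Proof. by rewrite finset.in_set; exact: asboolP. Qed.

Lemma restr_pats L x : shift_set X x -> restr L x \in pats L.
Proof. by move=> Xx; apply/patsP; exists x. Qed.

Lemma npat_gt0 L x : shift_set X x -> (0 < npat L)%N.
Proof. by move=> /(restr_pats L) xL; apply/card_gt0P; exists (restr L x). Qed.

Lemma npat_cover L L1 L2 : (L `<=` L1 `|` L2)%fset ->
  (npat L <= npat L1 * #|A| ^ #|` L2|)%N.
Proof.
move=> /fsubsetP LL; have <- : #|{ffun L2 -> A}| = (#|A| ^ #|` L2|)%N.
  by rewrite card_ffun cardfE.
rewrite -cardsT -cardsX.
apply: (@leq_card_rel _ _ _ _ (fun f q =>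
  exists x, [/\ f = restr L x, q.1 = restr L1 x & q.2 = restr L2 x])).
  move=> _ /patsP[x Xx ->]; exists (restr L1 x, restr L2 x); last by exists x.
  by rewrite finset.in_setX restr_pats // finset.in_setT.
move=> _ _ q [x [-> -> ->]] [y [-> /restrP xy1 /restrP xy2]].
by apply/restrP => l /LL; rewrite in_fsetU => /orP[/xy1|/xy2].
Qed.

Lemma npat_translate (g : G) T : (npat T <= npat (ltranslate g T))%N.
Proof.
apply: (@leq_card_rel _ _ _ _ (fun f q => exists x,
  f = restr T x /\ q = restr (ltranslate g T) (translate g x))).
  move=> _ /patsP[x Xx ->]; exists (restr (ltranslate g T) (translate g x)).
    exact/restr_pats/shift_invariant.
  by exists x.
move=> _ _ q [x [-> ->]] [y [-> /restrP xy]]; apply/restrP => t tT.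
by have := xy (g * t); rewrite /translate mem_ltranslate mulKg; exact.
Qed.

(** Two points differ at some site [h], and translation by [t * h^-1] moves [h] to [t]. *)
Lemma npat_site t : (exists x y, [/\ shift_set X x, shift_set X y & x <> y]) ->
  (1 < npat [fset t]%fset)%N.
Proof.
move=> [x [y [Xx Xy xy]]].
have [h xyh] : exists h, x h <> y h.
  by apply: contra_notP xy => /forallNP xy; apply/funext => h; exact: contrapT.
pose f z := restr [fset t]%fset (translate (t * h^-1) z).
have fX z : shift_set X z -> f z \in pats [fset t]%fset.
  by move=> Xz; exact/restr_pats/shift_invariant.
rewrite /npat (cardsD1 (f x)) fX // add1n ltnS card_gt0; apply/finset.set0Pn.
exists (f y); rewrite finset.in_setD1 fX // andbT; apply/eqP => /restrP /(_ t (fset11 t)).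
by rewrite /translate invgM invgK mulgVK => /esym.
Qed.

Context (B : {fset G}) (B1 : 1 \in B) (BV : forall b, b \in B -> b^-1 \in B)
  (glueX : gluing X B).

Lemma npat_glue L H K : (H `<=` L)%fset -> (K `<=` L)%fset ->
  (forall h k, h \in H -> k \in K -> h^-1 * k \notin B) ->
  (npat H * npat K <= npat L)%N.
Proof.
move=> /fsubsetP HL /fsubsetP KL HK; rewrite -cardsX.
apply: (@leq_card_rel _ _ _ _ (fun p f => exists x,
   [/\ f = restr L x, p.1 = restr H x & p.2 = restr K x])).
  case=> p1 p2; rewrite finset.in_setX /= => /andP[/patsP[x Xx ->] /patsP[y Xy ->]].
  have [z [Xz zx zy]] := glueX HK Xx Xy.
  exists (restr L z); first exact: restr_pats.
  by exists z; split=> //=; apply/restrP => g gH; [rewrite zx|rewrite zy].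
case=> p1 p2 [q1 q2] _ [x [/= -> -> ->]] [y [/= /restrP xy -> ->]].
by congr pair; apply/restrP => g gH; apply: xy; [exact: HL|exact: KL].
Qed.

(** Greedy choice: removing [t B] costs at most [#|B|] sites and leaves a set independent of the
    site [t], which carries at least two symbols. *)
Lemma npat_exp2 T (k : nat) :
  (exists x y, [/\ shift_set X x, shift_set X y & x <> y]) ->
  (k * #|` B| <= #|` T| -> 2 ^ k <= npat T)%N.
Proof.
move=> ntX; have [x [_ [Xx _ _]]] := ntX.
elim: k T => [|k IH] T kT; first by rewrite expn0 (npat_gt0 T Xx).
have b0 : (0 < #|` B|)%N by rewrite cardfs_gt0; apply/fset0Pn; exists 1.
have /fset0Pn[t tT] : T != fset0 by rewrite -cardfs_gt0; nia.
have /IH Tk : (k * #|` B| <= #|` (T `\` ltranslate t B)%fset|)%N.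
  have := cardfsID (ltranslate t B) T.
  have := fsubset_leq_card (fsubsetIr T (ltranslate t B)).
  rewrite card_ltranslate; move: kT; rewrite mulSn; lia.
rewrite expnS; apply: leq_trans (leq_mul (npat_site t ntX) Tk) _.
apply: npat_glue; [by rewrite fsub1set|exact: fsubsetDl|].
by move=> h k0 /fset1P->; rewrite in_fsetD mem_ltranslate => /andP[].
Qed.

(** Outside [d T B] patterns glue freely with those on [d T]; the power of [#|A|] pays for the
    arbitrary symbols on the boundary between the two. *)
Lemma npat_remove_tile L T (d : G) : (ltranslate d T `<=` L)%fset ->
  (npat (L `\` ltranslate d T)%fset * npat T
     <= npat L * #|A| ^ #|` (fset_mul T B `\` T)%fset|)%N.
Proof.
move=> dTL; rewrite -(card_ltranslate d) ltranslateD.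
set E := ltranslate d (fset_mul T B).
have cov : (L `\` ltranslate d T `<=` (L `\` E) `|` (E `\` ltranslate d T))%fset.
  apply/fsubsetP => l; rewrite !inE => /andP[-> ->].
  by rewrite !andbT orNb.
apply: leq_trans (leq_mul (npat_cover cov) (npat_translate d T)) _.
rewrite mulnAC leq_mul2r; apply/orP; right.
apply: npat_glue dTL _ => [|h k]; first exact: fsubsetDl.
rewrite in_fsetD => /andP[hE _] kT; apply: contra hE => hkB.
rewrite /E -fset_mul_ltranslate; have := mem_fset_mul kT (BV hkB).
by rewrite invgM invgK mulVKg.
Qed.

(** Tiles are removed one at a time, which disjointness allows; [q] is the net gain of a tile after
    its boundary is paid for. *)
Lemma npat_remove_tiles L T (E : {fset G}) (q : nat) :
  (q * #|A| ^ #|` (fset_mul T B `\` T)%fset| <= npat T)%N ->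
  (0 < #|A|)%N ->
  (forall e, e \in E -> (ltranslate e T `<=` L)%fset) ->
  {in E &, forall e e', e != e' -> [disjoint ltranslate e T & ltranslate e' T]%fset} ->
  (npat (L `\` fset_mul E T)%fset * q ^ #|` E| <= npat L)%N.
Proof.
move=> qT A0; have [n En] := ubnP #|` E|; elim: n E En => // n IH E En EL Edis.
have [->|/fset0Pn[e eE]] := eqVneq E fset0.
  rewrite cardfs0 expn0 muln1.
  suff -> : (L `\` fset_mul fset0 T)%fset = L by [].
  by apply/fsetP => l; rewrite in_fsetD andb_idl // => _; apply/fset_mulP => -[a [b []]].
pose E' := (E `\ e)%fset.
have E'E : {subset E' <= E} by apply/fsubsetP; exact: fsubsetDl.
have cE : #|` E| = #|` E'|.+1 by rewrite (cardfsD1 e) eE.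
have {}IH : (npat (L `\` fset_mul E' T)%fset * q ^ #|` E'| <= npat L)%N.
  apply: IH => [|f /E'E|f f' /E'E fE /E'E]; [by rewrite -ltnS -cE|exact: EL|exact: Edis].
have sub : (ltranslate e T `<=` L `\` fset_mul E' T)%fset.
  apply/fsubsetP => x xe; rewrite in_fsetD (fsubsetP (EL e eE)) // andbT.
  apply/fset_mulP => -[f [t [fE' tT xft]]].
  move: (fE'); rewrite in_fsetD1 => /andP[fe fE].
  have /fdisjointP/(_ x) := Edis _ _ fE eE fe.
  by rewrite xe mem_ltranslate xft mulKg => /(_ tT).
have EE : (L `\` fset_mul E T)%fset
    = ((L `\` fset_mul E' T) `\` ltranslate e T)%fset.
  apply/fsetP => x; rewrite !in_fsetD andbA -negb_or; congr (~~ _ && _).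
  rewrite mem_ltranslate; apply/fset_mulP/orP.
    move=> [f [t [fE tT ->]]]; have [->|fe] := eqVneq f e; first by left; rewrite mulKg.
    by right; rewrite mem_fset_mul // in_fsetD1 fe.
  move=> [xe|/fset_mulP[f [t [/E'E fE tT ->]]]]; last by exists f, t.
  by exists e, (e^-1 * x); rewrite mulVKg.
have b0 : (0 < #|A| ^ #|` (fset_mul T B `\` T)%fset|)%N by rewrite expn_gt0 A0.
have step : (npat (L `\` fset_mul E T)%fset * q <= npat (L `\` fset_mul E' T)%fset)%N.
  rewrite -(leq_pmul2r b0) EE -mulnA.
  by apply: leq_trans (npat_remove_tile sub); rewrite leq_mul2l qT orbT.
apply: leq_trans IH; rewrite cE expnS mulnA leq_mul2r step orbT //.
Qed.

End PatternCount.

(** * Sparse patterns and tiled configurations *)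

Section SparsePattern.
Context {G : groupType} {A : finType} (X : subshift G A) (B : {fset G}).
Context (BV : forall b, b \in B -> b^-1%g \in B)
  (glueX : gluing X B).
Implicit Types (x y z : config G A) (D : set G) (E K L T : {fset G}).
Local Open Scope group_scope.

Definition tiles T L E :=
  (forall e, e \in E -> (ltranslate e T `<=` L)%fset) /\
  {in E &, forall e e', e != e' -> [disjoint ltranslate e T & ltranslate e' T]%fset}.

(* Union bound over the tile positions [E]: prescribing [w] on [E T] costs a
   factor at least [s ^ (2 * #|E|)] in the number of patterns. *)
Lemma exists_sparse_pattern T L (w : config G A) (s k m : nat) : shift_set X w ->
  1 \in T -> (2 < s)%N -> (k.*2 <= s.+1)%N -> (0 < m)%N -> (#|` L| <= k * m)%N ->
  (s ^ 2 * #|A| ^ #|` (fset_mul T B `\` T)%fset| <= npat X T)%N ->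
  exists2 x, shift_set X x & forall E, tiles T L E ->
    (forall e t, e \in E -> t \in T -> x (e * t) = w t) -> (#|` E| < m)%N.
Proof.
move=> Xw T1 s2 ks m0 Lkm sT.
have A0 : (0 < #|A|)%N by apply/card_gt0P; exists (w 1).
(* Otherwise every point of [X] carries [w] on at least [m] disjoint tiles in [L], so the sets [C E]
   with [E] good cover all [L]-patterns. *)
apply: contrapT => noX.
pose car (E : {set L}) : {fset G} := [fset val e | e in E]%fset.
have car_card (E : {set L}) : #|` car E| = #|E|.
  by rewrite card_imfset; [rewrite -cardE|exact: val_inj].
pose carries E x := forall e t, e \in E -> t \in T -> x (e * t) = w t.
pose C (E : {set L}) : {set {ffun L -> A}} := finset (fun f =>
  `[< exists x, [/\ shift_set X x, f = restr L x & carries (car E) x] >]).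
pose good (E : {set L}) := (m <= #|E|)%N && `[< tiles T L (car E) >].
(* A pattern in [C E] is determined off [E T]. Each tile gains [s ^ 2], and [2 * #|E| >= m + #|E|]
   for good [E]. *)
have Ccard (E : {set L}) : good E -> (#|C E| * s ^ (m + #|E|) <= npat X L)%N.
  move=> /andP[mE /asboolP[EL Edis]].
  have := npat_remove_tiles BV glueX sT A0 EL Edis; rewrite car_card.
  apply: leq_trans; apply: leq_mul.
    apply: (@leq_card_rel _ _ _ _ (fun f q => exists x, [/\ f = restr L x,
      q = restr (L `\` fset_mul (car E) T)%fset x & carries (car E) x])).
      move=> f; rewrite finset.in_set => /asboolP[x [Xx -> xE]].
      exists (restr (L `\` fset_mul (car E) T)%fset x); first exact: restr_pats.
      by exists x.
    move=> _ _ q [x [-> -> xE]] [y [-> /restrP xy yE]]; apply/restrP => l lL.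
    have [/fset_mulP[e [t [eE tT ->]]]|lE] := boolP (l \in fset_mul (car E) T).
      by rewrite xE // yE.
    by rewrite xy // in_fsetD lE.
  by rewrite -expnM leq_exp2l //; lia.
have cover : (npat X L <= \sum_(E | good E) #|C E|)%N.
  have : pats X L \subset \bigcup_(E | good E) C E.
    apply/fintype.subsetP => _ /patsP[x Xx ->]; apply/finset.bigcupP.
    have [E [Et Ex mE]] : exists E, [/\ tiles T L E, carries E x & (m <= #|` E|)%N].
      apply: contrapT => noE; apply: noX; exists x => // E Et Ex.
      by rewrite ltnNge; apply/negP => mE; apply: noE; exists E.
    have EL : (E `<=` L)%fset.
      apply/fsubsetP => e eE; apply: (fsubsetP (Et.1 e eE)).
      by rewrite mem_ltranslate mulVg.
    have EE : car (fsub L E) = E.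
      apply/fsetP => e; apply/imfsetP/idP => [[l /= lE ->]|eE].
        by move: lE; rewrite in_fsub.
      by exists [` fsubsetP EL e eE]%fset; rewrite ?in_fsub.
    exists (fsub L E); first by rewrite /good -car_card EE mE; exact/asboolP.
    by rewrite finset.in_set; apply/asboolP; exists x; rewrite EE.
  move=> /subset_leq_card /leq_trans; apply.
  elim/big_rec2 : _ => [|E n U _ h]; first by rewrite finset.cards0.
  by apply: leq_trans (leq_card_setU _ _).1 _; rewrite leq_add2l.
set n := #|` L| in Lkm.
(* The part [s ^ #|E|] of the gain turns the sum over [E] into the binomial expansion; the part
   [s ^ m] makes the result contradictory. *)
have bound : (npat X L * s ^ (n + m) <= npat X L * s.+1 ^ n)%N.
  have -> : (s.+1 ^ n = \sum_(E : {set L}) s ^ (n - #|E|))%N.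
    by rewrite /n cardfE sum_expn_subset.
  rewrite big_distrr /=.
  apply: leq_trans (leq_mul cover (leqnn _)) _; rewrite big_distrl /=.
  rewrite [leqRHS](bigID good) /=; apply: leq_trans (leq_addr _ _).
  apply: leq_sum => E /Ccard h.
  have En : (#|E| <= n)%N by rewrite /n cardfE max_card.
  have -> : (n + m = (m + #|E|) + (n - #|E|))%N by lia.
  by rewrite expnD mulnA leq_mul2r h orbT.
move: bound; rewrite leq_pmul2l ?(npat_gt0 L Xw) //.
by rewrite leqNgt (leq_expSD s2 ks m0 Lkm).
Qed.

(** Zorn: separation concerns pairs, so it passes to unions of chains. Both quotients occur at the
    end because [W] need not be symmetric. *)
Lemma exists_maximal_separated (W Z : {fset G}) : exists D,
  [/\ forall d, D d -> d \notin Z,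
      forall d d', D d -> D d' -> d != d' -> d^-1 * d' \notin W &
      forall g, g \notin Z -> ~ D g ->
        exists2 d, D d & (d^-1 * g \in W) || (g^-1 * d \in W)].
Proof.
pose P : set (set G) := [set D | (forall d, D d -> d \notin Z) /\
  (forall d d', D d -> D d' -> d != d' -> d^-1 * d' \notin W)].
have [D [[DZ DW] Dmax]] : exists D, P D /\ forall D', D `<` D' -> ~ P D'.
  apply: Zorn_bigcup => F FP tot; split=> [d [D FD Dd]|d d' [D FD Dd] [D' FD' Dd']].
    exact: (FP _ FD).1.
  by have [DD|DD] := tot _ _ FD FD'; [apply: (FP _ FD').2|apply: (FP _ FD).2] => //; exact: DD.
exists D; split=> // g gZ nDg; apply: contrapT => noD.
have far d : D d -> (d^-1 * g \notin W) && (g^-1 * d \notin W).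
  by move=> Dd; rewrite -negb_or; apply/negP => h; apply: noD; exists d.
apply: (Dmax (D `|` [set g])).
  split; first by move=> d Dd; left.
  by move=> /(_ g (or_intror erefl)).
split=> [d [/DZ//|->//]|d d' [Dd|->] [Dd'|->]].
- exact: DW.
- by have /andP[] := far _ Dd.
- by have /andP[] := far _ Dd'.
- by rewrite eqxx.
Qed.

(** Translates of [w] are glued onto [y] one tile at a time; compactness then handles infinite
    [D]. *)
Lemma exists_tiled_config T K D (w y : config G A) : shift_set X w -> shift_set X y ->
  (forall d d', D d -> D d' -> d != d' ->
     d^-1 * d' \notin fset_mul (fset_mul T B) (fset_inv T)) ->
  (forall d, D d -> d \notin fset_mul (fset_mul K B) (fset_inv T)) ->
  exists x, [/\ shift_set X x, forall k, k \in K -> x k = y k &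
    forall d t, D d -> t \in T -> x (d * t) = w t].
Proof.
move=> Xw Xy Dsep DK.
have finite_tiled (s : seq G) : uniq s -> (forall d, d \in s -> D d) ->
    exists2 z, shift_set X z & (forall k, k \in K -> z k = y k) /\
      (forall d t, d \in s -> t \in T -> z (d * t) = w t).
  elim: s => [|d s IH] /=; first by exists y.
  move=> /andP[ds us] sD; have Dd : D d by apply: sD; rewrite mem_head.
  have [|z Xz [zK zs]] := IH us; first by move=> e es; apply: sD; rewrite inE es orbT.
  have [|u [Xu uz ud]] := glueX (K := (K `|` fset_mul [fset e in s] T)%fset)
      (H := ltranslate d T) _ Xz (shift_invariant d Xw).
    move=> k h; rewrite in_fsetU mem_ltranslate => kK hT; apply/negP => khB.
    (* A quotient in [B] between the new tile and [K] or an old tile would put [d] in [K B T^-1] or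
       [e^-1 d] in [T B T^-1]. *)
    have dE : d = k * (k^-1 * h) * (d^-1 * h)^-1 by rewrite mulVKg invgM invgK mulVKg.
    case/orP: kK => [kK|/fset_mulP[e [t [es tT kE]]]].
      have /negP := DK d Dd; apply; rewrite {1}dE.
      by rewrite !mem_fset_mul // mem_fset_inv invgK.
    move: es; rewrite in_fset => es.
    have ed : e != d by apply: contraNneq ds => <-.
    have De : D e by apply: sD; rewrite inE es orbT.
    have /negP := Dsep e d De Dd ed; apply.
    have -> : e^-1 * d = t * (k^-1 * h) * (d^-1 * h)^-1.
      by rewrite {1}dE kE !mulgA mulVg mul1g.
    by rewrite !mem_fset_mul // mem_fset_inv invgK.
  exists u => //; split=> [k kK|e t]; first by rewrite uz ?zK // in_fsetU kK.
  rewrite inE => /predU1P[->|es] tT.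
    by rewrite ud ?mem_ltranslate ?mulKg // /translate mulKg.
  by rewrite uz ?zs // in_fsetU mem_fset_mul ?orbT // in_fset.
have [M|x Xx xQ] := @exists_config _ _ _ (fun g a => (g \in K -> a = y g) /\
    (forall d t, D d -> t \in T -> g = d * t -> a = w t)) (@shift_closed _ _ X).
  (* Only centres in [M T^-1] have tiles meeting [M]. *)
  pose s := [seq d <- enum_fset (fset_mul M (fset_inv T)) | `[< D d >]].
  have [||z Xz [zK zs]] := finite_tiled s.
  - by rewrite filter_uniq // fset_uniq.
  - by move=> d; rewrite mem_filter => /andP[/asboolP].
  exists z => // g gM; split=> [/zK//|d t Dd tT gE].
  rewrite gE zs // mem_filter; apply/andP; split; first exact/asboolP.
  have -> : d = g * t^-1 by rewrite gE mulgK.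
  by apply: mem_fset_mul => //; rewrite mem_fset_inv invgK.
exists x; split=> // [k|d t Dd tT]; first by have [] := xQ k.
by have [_ /(_ d t Dd tT erefl)] := xQ (d * t).
Qed.

(** The part of [X] where the single word [q] on [L] is forbidden at all positions. *)
Definition avoid L (q : config G A) : set (config G A) :=
  [set x | shift_set X x /\ forall g, exists2 l, l \in L & x (g * l) <> q l].

Lemma avoid_closed L q : closed (avoid L q).
Proof.
apply: (closed_configP _).2 => x xq; split.
  apply: (closed_configP _).1 (@shift_closed _ _ X) _ _ => M.
  by have [z [Xz _] zx] := xq M; exists z.
move=> g; have [z [_ /(_ g)[l lL zl]] zx] := xq (ltranslate g L).
by exists l => //; rewrite -zx // mem_ltranslate mulKg.
Qed.

Lemma avoid_invariant L q h x : avoid L q x -> avoid L q (translate h x).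
Proof.
move=> [Xx xq]; split; first exact: shift_invariant.
by move=> g; have [l lL xl] := xq (h^-1 * g); exists l => //; rewrite /translate mulgA.
Qed.

End SparsePattern.

(** * A proper subshift with the same patterns on a given window *)

Theorem corollary1p8 (G : groupType) (A : finType)
    (countG : countable [set: G]) (infG : infinite_set [set: G])
    (S : seq G) (genS : generates S) (amenG : amenable G)
    (X : subshift G A)
    (nontrivX : exists x y, [/\ shift_set X x, shift_set X y & x <> y])
    (irrX : strongly_irreducible genS X) :
  ~ isolated [set: subshift G A] X.
Proof.
move=> [_ [V /nbhs_shiftP[_ /finite_fsetP[K ->] KV] VX]].
suff [Y [YX KY]] : exists Y : subshift G A, Y <> X /\
    patterns [set` K] Y = patterns [set` K] X.
  have : (V `&` [set: subshift G A]) Y by split=> //; exact: KV.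
  by rewrite VX.
have [B [B1 BV glueX]] := irreducible_gluing irrX.
have [w [_ [Xw _ _]]] := nontrivX.
pose be := #|` B|.
have be0 : (0 < be)%N by rewrite cardfs_gt0; apply/fset0Pn; exists 1%g.
have [T [T1 Tbig Tbd]] := amenable_right infG amenG B
  (be * (8 * (6 + 2 * be))) (8 * be * #|A|).
(* With this [s], the bound [#|W| <= t * t * be] gives [4 * #|W| <= s], as the union bound with
   [k = 2 * #|W|] demands. *)
pose t := #|` T|; pose s := (4 * (t * t * be))%N.
have sT : (s ^ 2 * #|A| ^ #|` (fset_mul T B `\` T)%fset| <= npat X T)%N.
  have h := @tile_count_beats be t (#|A| * #|` (fset_mul T B `\` T)%fset|) be0 Tbig
    ltac:(by rewrite mulnA).
  have := npat_exp2 B1 glueX nontrivX (leq_divM t be).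
  apply: leq_trans; apply: leq_trans h; rewrite leq_mul2l expnM; apply/orP; right.
  (* The boundary factor is absorbed through [#|A| <= 2 ^ #|A|]. *)
  case: (#|` _|) => // i; rewrite leq_exp2r //; exact/ltnW/ltn_expl.
pose W := fset_mul (fset_mul T B) (fset_inv T).
pose Z := fset_mul (fset_mul K B) (fset_inv T).
have t0 : (0 < t)%N by rewrite cardfs_gt0; apply/fset0Pn; exists 1%g.
have W1 : 1%g \in W.
  by rewrite -[1%g]mulg1 !mem_fset_mul ?mem_fset_inv ?invg1 // -[1%g]mulg1 mem_fset_mul.
have WV g : g \in W -> g^-1%g \in W.
  move=> /fset_mulP[_ [t' [/fset_mulP[u [b [uT bB ->]]] tT ->]]].
  rewrite !invgM mulgA !mem_fset_mul ?BV ?mem_fset_inv ?invgK //.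
  by rewrite -mem_fset_inv.
have Wt : (#|` W| <= t * t * be)%N.
  apply: leq_trans (card_fset_mul _ _) _; rewrite card_fset_inv.
  by rewrite mulnAC leq_mul2r card_fset_mul orbT.
have W0 : (0 < #|` W|)%N by rewrite cardfs_gt0; apply/fset0Pn; exists 1%g.
have [D [DZ DW Dmax]] := exists_maximal_separated W Z.
pose V' := fset_mul W T.
(* The constants 4 leave half of [L] after removing a translate of [Z] and the points near the
   boundary, each at most a quarter. *)
have [L [L1 Lbig Lbd]] := amenable_right infG amenG V' (4 * #|` Z|) (4 * #|` V'|).
set n := #|` L| in Lbig Lbd.
have n0 : (0 < n)%N by rewrite cardfs_gt0; apply/fset0Pn; exists 1%g.
(* [m] is the ceiling of [n / k], so [n <= k * m], while [n <= k * #|E|] implies [m <= #|E|]. *)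
pose k := (2 * #|` W|)%N; pose m := (n.-1 %/ k).+1.
have k0 : (0 < k)%N by rewrite muln_gt0.
have nkm : (n <= k * m)%N by rewrite mulnC -(prednK n0); exact: ltn_ceil.
have [q Xq qE] := exists_sparse_pattern BV glueX Xw T1 (s := s) (k := k)
  (L := L) (m := m) ltac:(rewrite /s; nia) ltac:(rewrite /s /k; lia) isT nkm sT.
exists (Subshift (@avoid_closed _ _ X L q) (@avoid_invariant _ _ X L q)).
split.
  move=> /(congr1 (@shift_set G A)) /= Yeq; move: Xq; rewrite -Yeq => -[_ /(_ 1%g)].
  by move=> [l _]; rewrite mul1g.
apply/seteqP; split=> _ [y /= Xy <-]; first by exists y => //; exact: Xy.1.
have [x [Xx xK xD]] := exists_tiled_config glueX Xw Xy DW DZ.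
exists x; last exact/eq_patternP.
split=> // g; apply: contrapT => noL.
have {noL} xq l : l \in L -> x (g * l)%g = q l.
  by move=> lL; apply: contrapT => xl; apply: noL; exists l.
(* If [x] shows [q] at [g], then [q] carries [w] on the tiles of [g^-1 D] inside [L]. Sparseness of
   [q] bounds their number by [m]; maximality of [D] contradicts this. *)
pose E := [fset e in L | `[< D (g * e)%g >] && (ltranslate e T `<=` L)%fset]%fset.
have EP e : e \in E -> D (g * e)%g /\ (ltranslate e T `<=` L)%fset.
  by rewrite !inE => /andP[_ /andP[/asboolP]].
have : (#|` E| < m)%N.
  apply: qE; first split=> [e /EP[]//|e e' /EP[De _] /EP[De' _] ee'].
    apply/fdisjointP => u; rewrite !mem_ltranslate => ue; apply/negP => ue'.
    have := DW _ _ De De'; rewrite (inj_eq (mulgI g)) => /(_ ee') /negP; apply.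
    have -> : ((g * e)^-1 * (g * e') = (e^-1 * u) * 1 * (e'^-1 * u)^-1)%g.
      by rewrite !invgM invgK mulg1 !mulgA mulgVK mulgK.
    by rewrite !mem_fset_mul // mem_fset_inv invgK.
  move=> e u /EP[De /fsubsetP eL] uT.
  by rewrite -xq ?eL ?mem_ltranslate ?mulKg // mulgA xD.
apply/negP; rewrite -leqNgt.
(* Contains every [l] in [L] for which [l V'] leaves [L]. *)
pose bad := fset_mul (fset_mul L V' `\` L)%fset (fset_inv V').
have cov : (L `<=` ltranslate g^-1 Z `|` bad `|` fset_mul E W)%fset.
  apply/fsubsetP => l lL; rewrite !in_fsetU mem_ltranslate invgK.
  have [|gZ] //= := boolP ((g * l)%g \in Z).
  have [|lbad] //= := boolP (l \in bad).
  have lV v : v \in V' -> (l * v)%g \in L.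
    move=> vV; apply: contraNT lbad => lv.
    rewrite -[l](mulgK v) mem_fset_mul ?mem_fset_inv ?invgK //.
    by rewrite in_fsetD lv mem_fset_mul.
  have [d Dd dl] : exists2 d, D d & (d^-1 * (g * l))%g \in W.
    have [Dgl|/Dmax] := pselect (D (g * l)%g); first by exists (g * l)%g; rewrite ?mulVg.
    move=> /(_ gZ)[d Dd /orP[]]; first by exists d.
    by move=> /WV; rewrite invgM invgK; exists d.
  have -> : l = ((g^-1 * d) * (d^-1 * (g * l)))%g by rewrite mulgA mulgK mulKg.
  apply: mem_fset_mul => //.
  (* By symmetry of [W], the tile at [g^-1 d] lies in [l W T = l V'], hence in [L]; [u = 1] gives
     its centre. *)
  have gdT u : u \in T -> (g^-1 * d * u)%g \in L.
    move=> uT; have -> : (g^-1 * d * u = l * ((d^-1 * (g * l))^-1 * u))%g.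
      by rewrite !invgM invgK !mulgA mulgV mul1g.
    by apply: lV; rewrite mem_fset_mul // WV.
  rewrite !inE -{1}[(g^-1 * d)%g]mulg1 gdT //= mulVKg; apply/andP; split; first exact/asboolP.
  by apply/fsubsetP => u; rewrite mem_ltranslate => /gdT; rewrite mulVKg.
have := fsubset_leq_card cov; rewrite -/n.
move=> /leq_trans /(_ (leq_card_fsetU _ _).1).
move=> /leq_trans /(_ (leq_add (leq_card_fsetU _ _).1 (card_fset_mul _ _))).
rewrite card_ltranslate => nb.
have badc : (#|` bad| <= #|` (fset_mul L V' `\` L)%fset| * #|` V'|)%N.
  by rewrite -(card_fset_inv V') card_fset_mul.
have nkE : (n <= k * #|` E|)%N by rewrite /k; lia.
by rewrite ltn_divLR // prednK // mulnC.
Qed.
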